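(* Let $m\ge 2$ and let $\mathcal{K}=\{z=(z_1,z_2)\in\mathbb{R}\times\mathbb{R}^{m-1}: z_1\ge\|z_2\|\}$ be the $m$-dimensional second-order cone. Then the metric projection operator $P_{\mathcal{K}}:\mathbb{R}^m\to\mathcal{K}$ has the following differentiability properties. (i) $P_{\mathcal{K}}$ is strictly Fréchet differentiable on $\mathcal{K}^o$, and $\nabla P_{\mathcal{K}}(z)=I_{\mathbb{R}^m}$ for every $z\in\mathcal{K}^o$. (ii) $P_{\mathcal{K}}$ is strictly Fréchet differentiable on $-\mathcal{K}^o$, and $\nabla P_{\mathcal{K}}(z)=0_{\mathbb{R}^m}$ for every $z\in-\mathcal{K}^o$. (iii) $P_{\mathcal{K}}$ is strictly Fréchet differentiable on $\mathbb{R}^m\setminus(-\mathcal{K}\cup\mathcal{K})$, and for any $z=(z_1,z_2)\in\mathbb{R}^m\setminus(-\mathcal{K}\cup\mathcal{K})$, with $\bar z_2=z_2/\|z_2\|$, $$\nabla P_{\mathcal{K}}(z)=\frac12\Big(1+\frac{z_1}{\|z_2\|}\Big)I_{\mathbb{R}^m}+\frac12\begin{bmatrix}-\dfrac{z_1}{\|z_2\|}&\bar z_2^T\\ \bar z_2&-\dfrac{z_1}{\|z_2\|}\bar z_2\bar z_2^T\end{bmatrix}.$$ (iv) On the set $-\mathrm{bd}\,\mathcal{K}\cup\mathrm{bd}\,\mathcal{K}$: (a) $P_{\mathcal{K}}$ is Gâteaux directionally differentiable at any $z\in-\mathrm{bd}\,\mathcal{K}\cup\mathrm{bd}\,\mathcal{K}$,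 and for any $h\in\mathbb{R}^m$, $$P_{\mathcal{K}}'(z)(h)=\begin{cases} h-2\big(c_1(z)^Th\big)_-\,c_1(z) & \text{if } z\in\mathrm{bd}\,\mathcal{K}\setminus\{0\},\\ 2\big(c_2(z)^Th\big)_+\,c_2(z) & \text{if } z\in-\mathrm{bd}\,\mathcal{K}\setminus\{0\},\\ (\lambda_1(h))_+\,c_1(h)+(\lambda_2(h))_+\,c_2(h) & \text{if } z=0.\end{cases}$$ (b) $P_{\mathcal{K}}$ is not Fréchet differentiable at any point $z\in-\mathrm{bd}\,\mathcal{K}\cup\mathrm{bd}\,\mathcal{K}$.
   Context: $\mathbb{R}^m=\mathbb{R}\times\mathbb{R}^{m-1}$ carries the Euclidean inner product and norm $\|\cdot\|$. $P_{\mathcal{K}}(z)$ is the unique point of $\mathcal{K}$ nearest to $z$. The interior and boundary of $\mathcal{K}$ are $\mathcal{K}^o=\{z: z_1>\|z_2\|\}$ and $\mathrm{bd}\,\mathcal{K}=\{z: z_1=\|z_2\|\}$; for a set $S$, $-S=\{-s:s\in S\}$. $I_{\mathbb{R}^m}$ is the identity map and $0_{\mathbb{R}^m}$ is the zero linear map of $\mathbb{R}^m$. For a real number $a$, $a_+=\max(0,a)$ and $a_-=\min(0,a)$ (so $a_-\le 0$). For $z=(z_1,z_2)\in\mathbb{R}\times\mathbb{R}^{m-1}$ and $i=1,2$ put $$\lambda_i(z)=z_1+(-1)^i\|z_2\|,\qquad c_i(z)=\tfrac12\big(1,(-1)^i\bar z_2\big),$$ where $\bar z_2=z_2/\|z_2\|$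 if $z_2\ne0$, and $\bar z_2$ is any (arbitrarily chosen) unit vector $w\in\mathbb{R}^{m-1}$ if $z_2=0$. Let $f:\mathbb{R}^m\to\mathbb{R}^m$. - $f$ is Gâteaux directionally differentiable at $x$ if $f'(x)(w):=\lim_{t\downarrow 0}\frac{f(x+tw)-f(x)}{t}$ exists for every direction $w$. - $f$ is Fréchet differentiable at $\bar x$ if there is a linear map $\nabla f(\bar x)$ with $\lim_{h\to0}\frac{\|f(\bar x+h)-f(\bar x)-\nabla f(\bar x)(h)\|}{\|h\|}=0$. - $f$ is strictly Fréchet differentiable at $\bar x$ if moreover $\lim_{(u,v)\to(\bar x,\bar x),\,u\neq v}\frac{\|f(u)-f(v)-\nabla f(\bar x)(u-v)\|}{\|u-v\|}=0$. - Each of these properties holds on a set if it holds at every point of the set. *)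

(* Defs.v *)
From HB Require Import structures.
From mathcomp Require Import all_boot all_order all_algebra.
From mathcomp Require Import all_classical all_reals all_analysis.

Set Implicit Arguments.
Unset Strict Implicit.
Unset Printing Implicit Defensive.

Import Order.TTheory GRing.Theory Num.Theory.
Import numFieldNormedType.Exports.

Local Open Scope classical_set_scope.
Local Open Scope ring_scope.

Section Euclidean.
Context {R : realType} {n : nat}.
Local Notation V := 'cV[R]_n.

Definition dot (u v : V) : R := (u^T *m v) ord0 ord0.

(* The norm `|v| that the library puts on 'cV[R]_n is the sup norm; the
   Euclidean norm has to be separate. Both induce the library's topology on
   'cV[R]_n, which is the one used in the limits below. *)
Definition enorm (v : V) : R := Num.sqrt (dot v v).

Definition nearest (K : set V) (z p : V) : Prop :=
  K p /\ forall q, K q -> enorm (z - p) <= enorm (z - q).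

Definition metric_proj (K : set V) (z : V) : V := get (nearest K z).

Definition dir_quot (f : V -> V) (x w : V) (t : R) : V :=
  t^-1 *: (f (x + t *: w) - f x).

Definition gateaux_dir_differentiable (f : V -> V) (x : V) : Prop :=
  forall w : V, cvg (dir_quot f x w t @[t --> (0 : R)^'+]).

Definition dir_deriv (f : V -> V) (x w : V) : V :=
  lim (dir_quot f x w t @[t --> (0 : R)^'+]).

Definition is_frechet_deriv (f : V -> V) (x : V) (L : {linear V -> V}) : Prop :=
  enorm (f (x + h) - f x - L h) / enorm h @[h --> (0 : V)^'] --> (0 : R).

Definition frechet_differentiable (f : V -> V) (x : V) : Prop :=
  exists L : {linear V -> V}, is_frechet_deriv f x L.

Definition nabla (f : V -> V) (x : V) : {linear V -> V} :=
  get (is_frechet_deriv f x).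

Definition strictly_frechet_differentiable (f : V -> V) (x : V) : Prop :=
  frechet_differentiable f x /\
  enorm (f uv.1 - f uv.2 - nabla f x (uv.1 - uv.2)) / enorm (uv.1 - uv.2)
    @[uv --> within [set uv : V * V | uv.1 <> uv.2] (nbhs (x, x))] --> (0 : R).

End Euclidean.

(* R^m = R x R^(m-1) is 'cV[R]_(1 + n) with n = m - 1. *)
Section SecondOrderCone.
Context {R : realType} {n : nat}.
Local Notation V := 'cV[R]_(1 + n).

Definition fst_part (z : V) : R := usubmx z ord0 ord0.
Definition snd_part (z : V) : 'cV[R]_n := dsubmx z.

Definition soc : set V := [set z | fst_part z >= enorm (snd_part z)].
Definition soc_int : set V := [set z | fst_part z > enorm (snd_part z)].
Definition soc_bd : set V := [set z | fst_part z = enorm (snd_part z)].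

Definition opp_set (S : set V) : set V := [set - s | s in S].

Definition normalize (v : 'cV[R]_n) : 'cV[R]_n := (enorm v)^-1 *: v.

(* w is the arbitrary unit vector used when z_2 = 0. *)
Definition zbar (w : 'cV[R]_n) (z : V) : 'cV[R]_n :=
  if snd_part z == 0 then w else normalize (snd_part z).

Definition spec_val (i : nat) (z : V) : R :=
  fst_part z + (-1) ^+ i * enorm (snd_part z).

Definition spec_vec (w : 'cV[R]_n) (i : nat) (z : V) : V :=
  2^-1 *: col_mx 1%:M ((-1) ^+ i *: zbar w z).

Definition mid_jacobian (z : V) : 'M[R]_(1 + n) :=
  let r := fst_part z / enorm (snd_part z) in
  let e := normalize (snd_part z) in
  (2^-1 * (1 + r)) *: 1%:M
  + 2^-1 *: block_mx (- r)%:M e^T e (- r *: (e *m e^T)).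

End SecondOrderCone.

Definition pos_part {R : realType} (a : R) : R := Num.max 0 a.
Definition neg_part {R : realType} (a : R) : R := Num.min 0 a.

(* Main.v *)
Require Import Defs.
From HB Require Import structures.
From mathcomp Require Import all_boot all_order all_algebra.
From mathcomp Require Import all_classical all_reals all_analysis.
From mathcomp Require Import ring lra.

Set Implicit Arguments.
Unset Strict Implicit.
Unset Printing Implicit Defensive.

Import Order.TTheory GRing.Theory Num.Theory.
Import numFieldNormedType.Exports.

Local Open Scope classical_set_scope.
Local Open Scope ring_scope.

(** With spectral values [l1 <= l2] and spectral vectors [c1], [c2], the projection
    is [P z = (l1)_+ c1 + (l2)_+ c2]: the remainder [(l1)_- c1 + (l2)_- c2] is
    orthogonal to it and has nonpositive inner product with the cone. Off the two
    boundaries this is locally the identity, zero, or [l2 c2], and in each case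
    [P u - P v = A(u, v) (u - v)] with a matrix [A] continuous on the diagonal,
    which is then the strict derivative. On the boundaries exactly one spectral
    value vanishes (or [z = 0] and [P] is positively homogeneous), which gives the
    directional derivatives; they are not odd in the direction, so [P] is not
    Frechet differentiable there. *)

(** * Euclidean inner product and norm, and the variational criterion for a metric projection *)

Section EuclideanTheory.
Context {R : realType} {n : nat}.
Implicit Types (u v w : 'cV[R]_n) (a : R).

Lemma dotE u v : dot u v = \sum_i u i ord0 * v i ord0.
Proof. by rewrite /dot mxE; apply: eq_bigr => i _; rewrite mxE. Qed.

Lemma dotC u v : dot u v = dot v u.
Proof. by rewrite !dotE; apply: eq_bigr => i _; rewrite mulrC. Qed.

Lemma dotDr u v w : dot u (v + w) = dot u v + dot u w.
Proof. by rewrite /dot mulmxDr mxE. Qed.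

Lemma dotZr a u v : dot u (a *: v) = a * dot u v.
Proof. by rewrite /dot -scalemxAr mxE. Qed.

Lemma dotNr u v : dot u (- v) = - dot u v.
Proof. by rewrite /dot mulmxN mxE. Qed.

Lemma dotDl u v w : dot (v + w) u = dot v u + dot w u.
Proof. by rewrite dotC dotDr !(dotC u). Qed.

Lemma dotZl a u v : dot (a *: u) v = a * dot u v.
Proof. by rewrite dotC dotZr dotC. Qed.

Lemma dotNl u v : dot (- u) v = - dot u v.
Proof. by rewrite dotC dotNr dotC. Qed.

Definition dot_bilinear := (dotDl, dotDr, dotZl, dotZr, dotNl, dotNr).

Lemma dot_ge0 v : 0 <= dot v v.
Proof. by rewrite dotE; apply: sumr_ge0 => i _; rewrite -expr2 sqr_ge0. Qed.

Lemma dot_eq0 v : (dot v v == 0) = (v == 0).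
Proof.
apply/eqP/eqP => [|->]; last by rewrite dotE big1 // => i _; rewrite mxE mul0r.
rewrite dotE => /psumr_eq0P H; apply/colP => i; rewrite mxE; apply/eqP.
by rewrite -sqrf_eq0 expr2 H // => j _; rewrite -expr2 sqr_ge0.
Qed.

Lemma enorm_ge0 v : 0 <= enorm v.
Proof. exact: sqrtr_ge0. Qed.

Lemma sqr_enorm v : enorm v ^+ 2 = dot v v.
Proof. by rewrite sqr_sqrtr ?dot_ge0. Qed.

Lemma enorm_eq0 v : (enorm v == 0) = (v == 0).
Proof. by rewrite -dot_eq0 -sqr_enorm sqrf_eq0. Qed.

Lemma enorm0 : enorm (0 : 'cV[R]_n) = 0.
Proof. by apply/eqP; rewrite enorm_eq0. Qed.

Lemma enorm_gt0 v : (0 < enorm v) = (v != 0).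
Proof. by rewrite lt_def enorm_ge0 andbT enorm_eq0. Qed.

Lemma enormZ a v : enorm (a *: v) = `|a| * enorm v.
Proof.
by rewrite /enorm !dot_bilinear mulrA -expr2 sqrtrM ?sqr_ge0 // sqrtr_sqr.
Qed.

Lemma enormN v : enorm (- v) = enorm v.
Proof. by rewrite /enorm !dot_bilinear opprK. Qed.

(** The squared norm of [enorm v *: u - enorm u *: v] expands to [2 * (|u||v|) * (|u||v| - u.v)]; it
    is nonnegative, and the positive factor can be cancelled. *)
Lemma cauchy_schwarz u v : dot u v <= enorm u * enorm v.
Proof.
have [u0|u0] := eqVneq u 0.
  by rewrite u0 enorm0 mul0r -(scale0r 0) dotZl mul0r.
have [v0|v0] := eqVneq v 0.
  by rewrite v0 enorm0 mulr0 -(scale0r 0) dotZr mul0r.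
have := dot_ge0 (enorm v *: u - enorm u *: v).
rewrite !dot_bilinear (dotC v u) -!sqr_enorm.
have : 0 < enorm u * enorm v by rewrite mulr_gt0 ?enorm_gt0.
set x := enorm u; set y := enorm v; set d := dot u v => xy H.
rewrite -(ler_pM2l xy) -subr_ge0.
suff : 0 <= 2 * (x * y * (x * y) - x * y * d) by rewrite pmulr_rge0.
by congr (0 <= _): H; ring.
Qed.

Lemma enorm_normalize v : v != 0 -> enorm (normalize v) = 1.
Proof.
move=> v0; rewrite /normalize enormZ ger0_norm ?invr_ge0 ?enorm_ge0 //.
by rewrite mulVf // enorm_eq0.
Qed.

Lemma enorm_normalizeK v : enorm v *: normalize v = v.
Proof.
have [->|v0] := eqVneq v 0; first by rewrite enorm0 scale0r.
by rewrite /normalize scalerA divff ?enorm_eq0 // scale1r.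
Qed.

(** Rationalizes a difference of norms: dividing by [enorm u + enorm v] makes the increment of the
    norm linear in [u - v]. *)
Lemma enormB_mul u v : (enorm u - enorm v) * (enorm u + enorm v) = dot (u + v) (u - v).
Proof.
rewrite !dot_bilinear (dotC v u) -!sqr_enorm; ring.
Qed.

(** Together with the next bound, this compares the Euclidean norm with the sup norm that defines
    the topology; the crude constant [n] comes from [n <= n ^ 2] and is enough for limits. *)
Lemma enorm_le_mx_norm v : enorm v <= n%:R * `|v|.
Proof.
rewrite -[leRHS]ger0_norm ?mulr_ge0 // -sqrtr_sqr ler_sqrt ?sqr_ge0 // dotE.
apply: (@le_trans _ _ (\sum_(i < n) `|v| ^+ 2)).
  apply: ler_sum => i _; rewrite -expr2 -[leLHS]ger0_norm ?sqr_ge0 // normrX.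
  rewrite lerXn2r ?nnegrE //.
  by rewrite [leRHS]/Num.norm /= mx_normrE; apply: (le_bigmax _ _ (i, ord0)).
rewrite sumr_const card_ord exprMn -[leLHS]mulr_natl ler_wpM2r ?sqr_ge0 //.
by rewrite -natrX ler_nat; case: (n) => // k; rewrite leq_pmulr.
Qed.

Lemma mx_norm_le_enorm v : `|v| <= enorm v.
Proof.
rewrite [leLHS]/Num.norm /= mx_normrE; apply/bigmax_leP; split=> [|[i j] _ /=].
  exact: enorm_ge0.
rewrite (ord1 j) -sqrtr_sqr ler_sqrt ?dot_ge0 // dotE (bigD1 i) //= expr2.
by rewrite lerDl sumr_ge0 // => k _; rewrite -expr2 sqr_ge0.
Qed.

(** Expanding [|z - q|^2] around [p] shows that [p] is nearest. Any nearest point [g] then satisfies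
    [|g - p|^2 <= 2 (z - p).(g - p) <= 0], so the choice made by [get] can only be [p]. *)
Lemma metric_projP (K : set 'cV[R]_n) (z p : 'cV[R]_n) :
  K p -> (forall q, K q -> dot (z - p) (q - p) <= 0) -> metric_proj K z = p.
Proof.
move=> Kp var.
have pyth q : enorm (z - q) ^+ 2 =
    enorm (z - p) ^+ 2 + enorm (q - p) ^+ 2 - 2 * dot (z - p) (q - p).
  have -> : z - q = (z - p) - (q - p) by rewrite opprB addrA subrK.
  move: (z - p) (q - p) => a b.
  by rewrite !sqr_enorm !dot_bilinear (dotC b a); ring.
have pnear : nearest K z p.
  split=> // q Kq; rewrite -ler_sqr ?nnegrE ?enorm_ge0 // (pyth q).
  by have := var _ Kq; have := sqr_ge0 (enorm (q - p)); lra.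
have [Kg gnear] : nearest K z (metric_proj K z) by apply: getI pnear.
apply/eqP; rewrite -subr_eq0 -enorm_eq0 -sqrf_eq0 eq_le sqr_ge0 andbT.
have := gnear _ Kp; rewrite -ler_sqr ?nnegrE ?enorm_ge0 // (pyth (metric_proj K z)).
by have := var _ Kg; lra.
Qed.

End EuclideanTheory.

(** * Positive and negative parts of a real number *)

Lemma pos_neg_part {R : realType} (a : R) : pos_part a + neg_part a = a.
Proof. by rewrite /pos_part /neg_part; case: (leP 0 a); rewrite ?addr0 ?add0r. Qed.

Lemma pos_part_ge0 {R : realType} (a : R) : 0 <= pos_part a.
Proof. by rewrite /pos_part le_max lexx. Qed.

Lemma neg_part_le0 {R : realType} (a : R) : neg_part a <= 0.
Proof. by rewrite /neg_part ge_min lexx. Qed.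

Lemma pos_partM_neg_part {R : realType} (a : R) : neg_part a * pos_part a = 0.
Proof. by rewrite /pos_part /neg_part; case: (leP 0 a); rewrite ?mul0r ?mulr0. Qed.

Lemma pos_partZ {R : realType} (t a : R) : 0 <= t -> pos_part (t * a) = t * pos_part a.
Proof. by move=> t0; rewrite /pos_part maxr_pMr // mulr0. Qed.

Lemma neg_partZ {R : realType} (t a : R) : 0 <= t -> neg_part (t * a) = t * neg_part a.
Proof. by move=> t0; rewrite /neg_part minr_pMr // mulr0. Qed.

(** * Spectral decomposition and the closed formula for the projection onto the cone *)

Section SecondOrderConeTheory.
Context {R : realType} {n : nat}.
Local Notation V := 'cV[R]_(1 + n).
Implicit Types (z q u v h : V) (w e : 'cV[R]_n) (a : R).

Lemma col_mx_parts z : col_mx (fst_part z)%:M (snd_part z) = z.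
Proof. by rewrite -[RHS]vsubmxK -mx11_scalar. Qed.

Lemma fst_part_col_mx a e : fst_part (col_mx a%:M e) = a.
Proof. by rewrite /fst_part col_mxKu mxE. Qed.

Lemma snd_part_col_mx a e : snd_part (col_mx a%:M e) = e.
Proof. by rewrite /snd_part col_mxKd. Qed.

Lemma fst_partD u v : fst_part (u + v) = fst_part u + fst_part v.
Proof. by rewrite /fst_part !mxE. Qed.

Lemma fst_partZ a u : fst_part (a *: u) = a * fst_part u.
Proof. by rewrite /fst_part !mxE. Qed.

Lemma fst_partN u : fst_part (- u) = - fst_part u.
Proof. by rewrite /fst_part !mxE. Qed.

Lemma snd_partD u v : snd_part (u + v) = snd_part u + snd_part v.
Proof. by apply/colP => i; rewrite !mxE. Qed.

Lemma snd_partZ a u : snd_part (a *: u) = a *: snd_part u.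
Proof. by apply/colP => i; rewrite !mxE. Qed.

Lemma snd_partN u : snd_part (- u) = - snd_part u.
Proof. by apply/colP => i; rewrite !mxE. Qed.

Definition partE := (fst_partD, fst_partZ, fst_partN, fst_part_col_mx,
  (snd_partD, snd_partZ, snd_partN, snd_part_col_mx)).

Lemma parts_inj u v :
  fst_part u = fst_part v -> snd_part u = snd_part v -> u = v.
Proof. by move=> e1 e2; rewrite -(col_mx_parts u) -(col_mx_parts v) e1 e2. Qed.

Lemma dot_parts u v :
  dot u v = fst_part u * fst_part v + dot (snd_part u) (snd_part v).
Proof.
rewrite -{1}(col_mx_parts u) -{1}(col_mx_parts v) /dot tr_col_mx mul_row_col.
by rewrite tr_scalar_mx -scalar_mxM !mxE.
Qed.

Lemma opp_setP (S : set V) z : opp_set S z <-> S (- z).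
Proof.
split=> [[s Ss <-]|Sz]; first by rewrite opprK.
by exists (- z) => //; rewrite opprK.
Qed.

Lemma fst_spec_vec w i z : fst_part (spec_vec w i z) = 2^-1.
Proof. by rewrite /spec_vec !partE mulr1. Qed.

Lemma snd_spec_vec w i z :
  snd_part (spec_vec w i z) = (2^-1 * (-1) ^+ i) *: zbar w z.
Proof. by rewrite /spec_vec !partE scalerA. Qed.

Lemma enorm_zbar w z : enorm w = 1 -> enorm (zbar w z) = 1.
Proof. by rewrite /zbar; case: ifPn => // z0 _; exact: enorm_normalize. Qed.

(** If [z_2 = 0] the factor [|z_2|] vanishes, so the arbitrary choice of [w] is harmless. *)
Lemma zbarK w z : enorm (snd_part z) *: zbar w z = snd_part z.
Proof.
rewrite /zbar; case: ifP => [/eqP ->|_]; last exact: enorm_normalizeK.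
by rewrite enorm0 scale0r.
Qed.

Lemma spec_decomp w z :
  spec_val 1 z *: spec_vec w 1 z + spec_val 2 z *: spec_vec w 2 z = z.
Proof.
apply: parts_inj; rewrite !(fst_spec_vec, snd_spec_vec, partE) /spec_val.
  by rewrite expr1 sqrrN expr1n; field.
rewrite -[RHS](zbarK w) !scalerA -scalerDl; congr (_ *: _).
by rewrite expr1 sqrrN expr1n; field.
Qed.

(** The dependence on [w] is only formal: by [metric_proj_soc] all unit vectors [w] give the same
    point. *)
Definition soc_proj w z : V :=
  pos_part (spec_val 1 z) *: spec_vec w 1 z
  + pos_part (spec_val 2 z) *: spec_vec w 2 z.

Lemma sub_soc_proj w z : z - soc_proj w z =
  neg_part (spec_val 1 z) *: spec_vec w 1 z
  + neg_part (spec_val 2 z) *: spec_vec w 2 z.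
Proof.
rewrite -{1}(spec_decomp w z) -{1}(pos_neg_part (spec_val 1 z)).
rewrite -{1}(pos_neg_part (spec_val 2 z)) /soc_proj !scalerDl opprD.
by apply/matrixP => i j; rewrite !mxE; ring.
Qed.

(** Since [zbar] is a unit vector, [c_1] and [c_2] are orthogonal and each has squared norm 1/2. *)
Lemma dot_spec_vec w i j z : enorm w = 1 ->
  dot (spec_vec w i z) (spec_vec w j z) = 2^-1 ^+ 2 * (1 + (-1) ^+ (i + j)).
Proof.
move=> w1; rewrite dot_parts !fst_spec_vec !snd_spec_vec !dot_bilinear.
by rewrite -sqr_enorm enorm_zbar // exprD; ring.
Qed.

(** By Cauchy-Schwarz [-(+-zbar).q_2 <= |q_2| <= q_1]: the spectral vectors belong to the dual
    cone. *)
Lemma dot_spec_vec_soc w i z q : enorm w = 1 -> soc q ->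
  0 <= dot (spec_vec w i z) q.
Proof.
move=> w1 Kq; rewrite dot_parts fst_spec_vec snd_spec_vec !dot_bilinear -mulrA -mulrDr.
rewrite pmulr_rge0 // -dotZl.
have := cauchy_schwarz (- ((-1) ^+ i *: zbar w z)) (snd_part q).
rewrite dotNl enormN enormZ normrX normrN1 expr1n mul1r enorm_zbar // mul1r.
by move: Kq; rewrite /soc /=; lra.
Qed.

(** For coefficients [a, b >= 0] the two parts are [(a + b)/2] and [(b - a)/2] times a unit
    vector. *)
Lemma soc_proj_soc w z : enorm w = 1 -> soc (soc_proj w z).
Proof.
move=> w1; rewrite /soc /= /soc_proj !(fst_spec_vec, snd_spec_vec, partE).
rewrite !scalerA -scalerDl enormZ enorm_zbar // mulr1 expr1 sqrrN expr1n.
have := pos_part_ge0 (spec_val 1 z); have := pos_part_ge0 (spec_val 2 z).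
by rewrite ler_norml => *; apply/andP; split; lra.
Qed.

Lemma metric_proj_soc w z : enorm w = 1 -> metric_proj soc z = soc_proj w z.
Proof.
move=> w1; apply: metric_projP => [|q Kq]; first exact: soc_proj_soc.
(* Mixed terms vanish because [c_1] and [c_2] are orthogonal, diagonal ones because a number's
   positive and negative parts have product zero. *)
have orth : dot (z - soc_proj w z) (soc_proj w z) = 0.
  rewrite sub_soc_proj /soc_proj.
  move: (fun i j => dot_spec_vec i j z w1); move: (spec_vec w) => c cE.
  rewrite !dot_bilinear !cE /=.
  have := pos_partM_neg_part (spec_val 1 z).
  have := pos_partM_neg_part (spec_val 2 z).
  move: (pos_part _) (neg_part _) (pos_part _) (neg_part _) => x y x' y' yx yx'.
  transitivity (2^-1 * (y * x) + 2^-1 * (y' * x')); first by field.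
  by rewrite yx yx' !mulr0 addr0.
rewrite dotDr dotNr orth subr0 sub_soc_proj dotDl.
have H (i : nat) : neg_part (spec_val i z) * dot (spec_vec w i z) q <= 0.
  by rewrite mulr_le0_ge0 ?neg_part_le0 ?dot_spec_vec_soc.
by rewrite -[leRHS]addr0 lerD // dotZl.
Qed.

End SecondOrderConeTheory.

(** * Limits of matrix expressions and of spectral data along an arbitrary filter *)

Section Limits.
Context {R : realType} {T : Type} {F : set_system T} {FF : Filter F}.

Lemma cvg_mx m n (f : T -> 'M[R]_(m, n)) (l : 'M[R]_(m, n)) :
  (forall i j, f x i j @[x --> F] --> l i j) -> f x @[x --> F] --> l.
Proof.
move=> fl; apply/cvgrPdist_le => e e0.
have H : \forall x \near F, forall ij : 'I_m * 'I_n,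
    `|l ij.1 ij.2 - f x ij.1 ij.2| <= e.
  by apply: filter_forall => -[i j]; move/cvgrPdist_le: (fl i j); exact.
apply: filterS H => x H; rewrite [leLHS]/Num.norm /= mx_normrE.
apply/bigmax_leP; split=> [|ij _]; first exact: ltW.
by rewrite !mxE; exact: H.
Qed.

Lemma cvg_coord m n (f : T -> 'M[R]_(m, n)) (l : 'M[R]_(m, n)) i j :
  f x @[x --> F] --> l -> f x i j @[x --> F] --> l i j.
Proof.
move=> fl; apply: (@continuous_cvg _ _ _ _ _ f (fun M : 'M[R]_(m, n) => M i j)) fl.
exact: coord_continuous.
Qed.

Lemma cvg_trmx m n (f : T -> 'M[R]_(m, n)) (l : 'M[R]_(m, n)) :
  f x @[x --> F] --> l -> (f x)^T @[x --> F] --> l^T.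
Proof.
move=> fl; apply: cvg_mx => i j; rewrite mxE.
by under eq_fun do rewrite mxE; exact: cvg_coord.
Qed.

Lemma cvg_mulmx m n p (f : T -> 'M[R]_(m, n)) (g : T -> 'M[R]_(n, p))
    (a : 'M[R]_(m, n)) (b : 'M[R]_(n, p)) :
  f x @[x --> F] --> a -> g x @[x --> F] --> b ->
  f x *m g x @[x --> F] --> a *m b.
Proof.
move=> fa gb; apply: cvg_mx => i j; rewrite mxE.
under eq_fun do rewrite mxE.
apply: (@cvg_big _ _ +%R) => [|k _]; first exact: add_continuous.
by apply: cvgM; exact: cvg_coord.
Qed.

Lemma cvg_col_mx m1 m2 n (f : T -> 'M[R]_(m1, n)) (g : T -> 'M[R]_(m2, n))
    (a : 'M[R]_(m1, n)) (b : 'M[R]_(m2, n)) :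
  f x @[x --> F] --> a -> g x @[x --> F] --> b ->
  col_mx (f x) (g x) @[x --> F] --> col_mx a b.
Proof.
move=> fa gb; apply: cvg_mx => i j; rewrite mxE.
by under eq_fun do rewrite mxE; case: (fintype.split i) => k; exact: cvg_coord.
Qed.

Lemma cvg_row_mx m n1 n2 (f : T -> 'M[R]_(m, n1)) (g : T -> 'M[R]_(m, n2))
    (a : 'M[R]_(m, n1)) (b : 'M[R]_(m, n2)) :
  f x @[x --> F] --> a -> g x @[x --> F] --> b ->
  row_mx (f x) (g x) @[x --> F] --> row_mx a b.
Proof.
move=> fa gb; apply: cvg_mx => i j; rewrite mxE.
by under eq_fun do rewrite mxE; case: (fintype.split j) => k; exact: cvg_coord.
Qed.

Lemma cvg_block_mx m1 m2 n1 n2 (f : T -> 'M[R]_(m1, n1)) (g : T -> 'M[R]_(m1, n2))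
    (h : T -> 'M[R]_(m2, n1)) (k : T -> 'M[R]_(m2, n2))
    (a : 'M[R]_(m1, n1)) (b : 'M[R]_(m1, n2)) (c : 'M[R]_(m2, n1)) (d : 'M[R]_(m2, n2)) :
  f x @[x --> F] --> a -> g x @[x --> F] --> b ->
  h x @[x --> F] --> c -> k x @[x --> F] --> d ->
  block_mx (f x) (g x) (h x) (k x) @[x --> F] --> block_mx a b c d.
Proof.
by move=> fa gb hc kd; apply: cvg_col_mx; exact: cvg_row_mx.
Qed.

Lemma cvg_dot n (f g : T -> 'cV[R]_n) (a b : 'cV[R]_n) :
  f x @[x --> F] --> a -> g x @[x --> F] --> b ->
  dot (f x) (g x) @[x --> F] --> dot a b.
Proof. by move=> fa gb; apply/cvg_coord/cvg_mulmx => //; exact: cvg_trmx. Qed.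

Lemma cvg_enorm n (f : T -> 'cV[R]_n) (a : 'cV[R]_n) :
  f x @[x --> F] --> a -> enorm (f x) @[x --> F] --> enorm a.
Proof.
move=> fa; apply: (@continuous_cvg _ _ _ _ _ (fun x => dot (f x) (f x)) Num.sqrt).
  exact: sqrt_continuous.
exact: cvg_dot.
Qed.

Lemma cvg_normalize n (f : T -> 'cV[R]_n) (a : 'cV[R]_n) : a != 0 ->
  f x @[x --> F] --> a -> normalize (f x) @[x --> F] --> normalize a.
Proof.
move=> a0 fa; apply: cvgZ => //; apply: cvgV; first by rewrite enorm_eq0.
exact: cvg_enorm.
Qed.

Lemma cvg_fst_part n (f : T -> 'cV[R]_(1 + n)) (a : 'cV[R]_(1 + n)) :
  f x @[x --> F] --> a -> fst_part (f x) @[x --> F] --> fst_part a.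
Proof.
move=> fa; rewrite /fst_part mxE; under eq_fun do rewrite mxE.
exact: cvg_coord.
Qed.

Lemma cvg_snd_part n (f : T -> 'cV[R]_(1 + n)) (a : 'cV[R]_(1 + n)) :
  f x @[x --> F] --> a -> snd_part (f x) @[x --> F] --> snd_part a.
Proof.
move=> fa; apply: cvg_mx => i j; rewrite mxE; under eq_fun do rewrite mxE.
exact: cvg_coord.
Qed.

Lemma cvg_spec_val n i (f : T -> 'cV[R]_(1 + n)) (a : 'cV[R]_(1 + n)) :
  f x @[x --> F] --> a -> spec_val i (f x) @[x --> F] --> spec_val i a.
Proof.
move=> fa; apply: cvgD; first exact: cvg_fst_part.
by apply: cvgM; [exact: cvg_cst|apply/cvg_enorm/cvg_snd_part].
Qed.

(** Near a point with nonzero second part, [zbar] stays on its [normalize] branch, which is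
    continuous there. *)
Lemma cvg_spec_vec n w i (f : T -> 'cV[R]_(1 + n)) (a : 'cV[R]_(1 + n)) : snd_part a != 0 ->
  f x @[x --> F] --> a -> spec_vec w i (f x) @[x --> F] --> spec_vec w i a.
Proof.
move=> a0 fa; have fa2 := cvg_snd_part fa.
apply: cvgZ; first exact: cvg_cst.
apply: cvg_col_mx; first exact: cvg_cst.
apply: cvgZ; first exact: cvg_cst.
rewrite {2}/zbar (negbTE a0); apply: cvg_trans (cvg_normalize a0 fa2).
apply: near_eq_cvg; near=> x; rewrite /zbar ifN //.
by near: x; exact: cvgr_neq0 fa2 a0.
Unshelve. all: by end_near. Qed.

Lemma cvg_pos_part (f : T -> R) (a : R) :
  f x @[x --> F] --> a -> pos_part (f x) @[x --> F] --> pos_part a.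
Proof.
move=> fa; apply: (@continuous_cvg _ _ _ _ _ f pos_part) => //.
by apply: (@continuous_max _ _ (cst 0) id); [exact: cvg_cst|exact: cvg_id].
Qed.

Lemma cvg_neg_part (f : T -> R) (a : R) :
  f x @[x --> F] --> a -> neg_part (f x) @[x --> F] --> neg_part a.
Proof.
move=> fa; apply: (@continuous_cvg _ _ _ _ _ f neg_part) => //.
by apply: (@continuous_min _ _ (cst 0) id); [exact: cvg_cst|exact: cvg_id].
Qed.

End Limits.

(** * Directional, Fréchet and strict derivatives *)

Section Differentiability.
Context {R : realType} {n : nat}.
Local Notation V := 'cV[R]_n.
Implicit Types (f : V -> V) (x w h : V).

(** Restrict the Fréchet limit to the ray [h = t *: w]; the direction [w = 0] is treated apart. *)
Lemma frechet_dir_cvg f x (L : {linear V -> V}) w :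
  is_frechet_deriv f x L -> dir_quot f x w t @[t --> (0 : R)^'+] --> L w.
Proof.
move=> dfL; have [->|w0] := eqVneq w 0.
  rewrite linear0 /dir_quot.
  under eq_fun do rewrite scaler0 addr0 subrr scaler0.
  exact: cvg_cst.
(* The Fréchet limit is over a punctured neighbourhood, in which [t *: w] stays because [t > 0] and
   [w] is nonzero. *)
have tw : t *: w @[t --> (0 : R)^'+] --> (0 : V)^'.
  move=> A; rewrite /dnbhs /within /= => A0.
  have : t *: w @[t --> (0 : R)^'+] --> (0 : V).
    rewrite -(scale0r w); apply: cvgZ; last exact: cvg_cst.
    exact: cvg_at_right_filter cvg_id.
  move=> /(_ _ A0) H; change (\forall t \near (0 : R)^'+, A (t *: w)).
  near=> t; have t0 : 0 < t by near: t; exact: nbhs_right_gt.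
  have : t *: w != 0.
    by rewrite scaler_eq0 negb_or w0 andbT gt_eqF.
  by near: t; exact: H.
(* As [|t w| = t |w|], the factor [enorm w] turns division by [|t w|] into division by [t]. *)
have dq : enorm (f (x + t *: w) - f x - L (t *: w)) / enorm (t *: w) * enorm w
    @[t --> (0 : R)^'+] --> (0 : R).
  rewrite -[X in _ --> X](mul0r (enorm w)); apply: cvgM; last exact: cvg_cst.
  exact: cvg_comp tw dfL.
apply/cvgrPdist_le => e e0; move/cvgr0Pnorm_le: dq => /(_ _ e0) dq.
near=> t; have t0 : 0 < t by near: t; exact: nbhs_right_gt.
rewrite distrC; apply: le_trans (mx_norm_le_enorm _) _.
suff <- : enorm (f (x + t *: w) - f x - L (t *: w)) / enorm (t *: w) * enorm w
    = enorm (dir_quot f x w t - L w).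
  by apply: le_trans (ler_norm _) _; near: t.
have -> : dir_quot f x w t - L w = t^-1 *: (f (x + t *: w) - f x - L (t *: w)).
  by rewrite linearZ /= /dir_quot [RHS]scalerBr scalerA mulVf ?gt_eqF // scale1r.
rewrite !enormZ !ger0_norm ?invr_ge0 ?(ltW t0) //.
by rewrite invfM mulrA mulfVK ?enorm_eq0 // mulrC.
Unshelve. all: by end_near. Qed.

(** A derivative is determined by its directional limits, so the one chosen by [get] agrees with [L]
    pointwise. *)
Lemma nabla_eq f x (L : {linear V -> V}) :
  is_frechet_deriv f x L -> nabla f x =1 L.
Proof.
move=> dfL w; have dfN : is_frechet_deriv f x (nabla f x) := getI dfL.
by apply: (cvg_unique _ (frechet_dir_cvg dfN) (frechet_dir_cvg dfL)).
Qed.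

Lemma dir_deriv_eq f x w (l : V) :
  dir_quot f x w t @[t --> (0 : R)^'+] --> l -> dir_deriv f x w = l.
Proof. exact: cvg_lim. Qed.

(** A linear derivative is odd, so the limits along [w] and [- w] would cancel. *)
Lemma not_frechet_differentiable f x w (l l' : V) :
  dir_quot f x w t @[t --> (0 : R)^'+] --> l ->
  dir_quot f x (- w) t @[t --> (0 : R)^'+] --> l' ->
  l + l' != 0 -> ~ frechet_differentiable f x.
Proof.
move=> dl dl' ll' [L dfL].
have lE : l = L w by apply: (cvg_unique _ dl (frechet_dir_cvg dfL)).
have l'E : l' = L (- w) by apply: (cvg_unique _ dl' (frechet_dir_cvg dfL)).
by move: ll'; rewrite lE l'E linearN subrr eqxx.
Qed.

Lemma enorm_mulmx (A : 'M[R]_n) w : enorm (A *m w) <= n%:R ^+ 2 * `|A| * enorm w.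
Proof.
apply: le_trans (enorm_le_mx_norm _) _; rewrite expr2 -!mulrA ler_wpM2l //.
rewrite [leLHS]/Num.norm /= mx_normrE.
apply/bigmax_leP; split=> [|[i j] _ /=]; first by rewrite !mulr_ge0 ?enorm_ge0.
rewrite mxE; apply: le_trans (ler_norm_sum _ _ _) _.
apply: (@le_trans _ _ (\sum_(k < n) `|A| * enorm w)).
  apply: ler_sum => k _; rewrite normrM ler_pM //.
    by rewrite [leRHS]/Num.norm /= mx_normrE; apply: (le_bigmax _ _ (i, k)).
  apply: le_trans (mx_norm_le_enorm w).
  by rewrite [leRHS]/Num.norm /= mx_normrE; apply: (le_bigmax _ _ (k, j)).
by rewrite sumr_const card_ord mulr_natl.
Qed.

(* Caratheodory-style criterion: a slope matrix continuous at the diagonal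
   point is a strict derivative. *)
Lemma strict_slope f x (A : V * V -> 'M[R]_n) (A0 : 'M[R]_n) :
  (\forall uv \near (x, x), f uv.1 - f uv.2 = A uv *m (uv.1 - uv.2)) ->
  A uv @[uv --> (x, x)] --> A0 ->
  strictly_frechet_differentiable f x /\ forall h, nabla f x h = A0 *m h.
Proof.
move=> fA AA0.
have small : forall e : R, 0 < e -> \forall uv \near (x, x),
    enorm (f uv.1 - f uv.2 - A0 *m (uv.1 - uv.2)) / enorm (uv.1 - uv.2) <= e.
  (* [n ^ 2] is the constant of [enorm_mulmx]; adding 1 makes [C] positive for every [n]. *)
  move=> e e0; pose C : R := n%:R ^+ 2 + 1.
  have C0 : 0 < C by rewrite ltr_wpDl ?sqr_ge0.
  near=> uv.
  have -> : f uv.1 - f uv.2 = A uv *m (uv.1 - uv.2) by near: uv.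
  rewrite -mulmxBl; set w := uv.1 - uv.2.
  (* On the diagonal the quotient is 0 because the inverse of 0 is 0, so the bound holds on a full
     neighbourhood of [(x, x)]. *)
  have [->|w0] := eqVneq w 0; first by rewrite enorm0 invr0 mulr0 ltW.
  rewrite ler_pdivrMr ?enorm_gt0 //; apply: le_trans (enorm_mulmx _ _) _.
  rewrite ler_wpM2r ?enorm_ge0 //.
  have : `|A0 - A uv| <= e / C.
    by near: uv; move/cvgrPdist_le: AA0; apply; rewrite divr_gt0.
  rewrite distrC ler_pdivlMr // mulrC; apply: le_trans.
  by rewrite ler_wpM2r // lerDl.
have dfA0 : is_frechet_deriv f x (mulmx A0).
  apply/cvgr0Pnorm_le => e e0.
  (* The Fréchet quotient is the strict quotient taken along the pairs [(x + h, x)]. *)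
  have xx : (x + h, x) @[h --> (0 : V)^'] --> (x, x).
    have xh : x + h @[h --> (0 : V)^'] --> x.
      rewrite -[X in _ --> X]addr0; apply: cvg_within_filter.
      by apply: cvgD; [exact: cvg_cst|exact: cvg_id].
    exact: (cvg_pair xh (cvg_cst x)).
  move: (xx _ (small _ e0)); rewrite /nbhs /=; apply: filterS => h /=.
  rewrite (addrC x h) addrK ger0_norm //.
  by rewrite divr_ge0 ?enorm_ge0.
have nablaE := nabla_eq dfA0.
split=> [|h]; last exact: nablaE.
split; first by exists (mulmx A0).
apply/cvgr0Pnorm_le => e e0; apply: cvg_within.
apply: filterS (small _ e0) => uv.
by rewrite nablaE /= ger0_norm // divr_ge0 ?enorm_ge0.
Unshelve. all: by end_near. Qed.

End Differentiability.

(** * Branches of the projection, slopes and one-sided derivatives of the spectral data *)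

Section ConeProjection.
Context {R : realType} {n : nat}.
Local Notation V := 'cV[R]_(1 + n).
Implicit Types (z u v h : V) (w : 'cV[R]_n).

Lemma spec_val1E z : spec_val 1 z = fst_part z - enorm (snd_part z).
Proof. by rewrite /spec_val expr1 mulN1r. Qed.

Lemma spec_val2E z : spec_val 2 z = fst_part z + enorm (snd_part z).
Proof. by rewrite /spec_val sqrrN expr1n mul1r. Qed.

Lemma spec_val_le z : spec_val 1 z <= spec_val 2 z.
Proof. by rewrite spec_val1E spec_val2E; have := enorm_ge0 (snd_part z); lra. Qed.

(** The form suited to a neighbourhood of a nonzero point of [bd K]: there [spec_val 2] is positive
    and only [spec_val 1] can change sign. *)
Lemma soc_projE_sub w z : 0 <= spec_val 2 z ->
  soc_proj w z = z - neg_part (spec_val 1 z) *: spec_vec w 1 z.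
Proof.
move=> l2; apply/eqP; rewrite eq_sym subr_eq addrC -subr_eq; apply/eqP.
by rewrite sub_soc_proj [neg_part (spec_val 2 z)]min_l // scale0r addr0.
Qed.

Lemma soc_projE_pos w z : spec_val 1 z <= 0 ->
  soc_proj w z = pos_part (spec_val 2 z) *: spec_vec w 2 z.
Proof. by move=> l1; rewrite /soc_proj [pos_part _]max_l // scale0r add0r. Qed.

Lemma soc_proj_id w z : 0 <= spec_val 1 z -> soc_proj w z = z.
Proof.
move=> l1; rewrite soc_projE_sub ?(le_trans l1 (spec_val_le z)) //.
by rewrite [neg_part _]min_l // scale0r subr0.
Qed.

Lemma soc_proj_eq0 w z : spec_val 2 z <= 0 -> soc_proj w z = 0.
Proof.
move=> l2; rewrite soc_projE_pos ?(le_trans (spec_val_le z) l2) //.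
by rewrite [pos_part _]max_l // scale0r.
Qed.

Lemma near_diag z (Q : V -> Prop) :
  (\forall u \near z, Q u) -> \forall uv \near (z, z), Q uv.1 /\ Q uv.2.
Proof. by move=> Qz; exists (Q, Q). Qed.

(* The increment of [u -> (u_1 + |u_2|) c_2(u)] between [v] and [u] is linear in
   [u - v] once [|u_2| - |v_2|] is written as
   [(u_2 + v_2) . (u_2 - v_2) / (|u_2| + |v_2|)]. *)
Definition mid_slope (uv : V * V) : 'M[R]_(1 + n) :=
  let r := enorm (snd_part uv.1) in
  let s := enorm (snd_part uv.2) in
  let e := (r + s)^-1 *: (snd_part uv.1 + snd_part uv.2) in
  2^-1 *: block_mx 1%:M e^T (r^-1 *: snd_part uv.2)
    ((1 + fst_part uv.1 * r^-1) *: 1%:M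
      - (fst_part uv.2 * (r^-1 * s^-1)) *: (snd_part uv.2 *m e^T)).

(** With [r = |u_2|] and [s = |v_2|], the second part rests on [u_1 u_2 / r - v_1 v_2 / s = (u_1 /
    r)(u_2 - v_2) + (u_1 - v_1) v_2 / r - v_1 v_2 (r - s) / (r s)]. *)
Lemma mid_slopeP w u v : snd_part u != 0 -> snd_part v != 0 ->
  spec_val 2 u *: spec_vec w 2 u - spec_val 2 v *: spec_vec w 2 v =
  mid_slope (u, v) *m (u - v).
Proof.
move=> u0 v0; rewrite /mid_slope /=.
have r0 : 0 < enorm (snd_part u) by rewrite enorm_gt0.
have s0 : 0 < enorm (snd_part v) by rewrite enorm_gt0.
set e := _ *: (snd_part u + snd_part v).
(* The row [e^T] converts [u_2 - v_2] into the difference of norms, by [enormB_mul]. *)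
have eE : e^T *m (snd_part u - snd_part v) =
    (enorm (snd_part u) - enorm (snd_part v))%:M.
  rewrite [LHS]mx11_scalar; congr (_%:M); rewrite -/(dot _ _) dotZl -enormB_mul.
  by rewrite mulrC mulfK // gt_eqF // addr_gt0.
rewrite -{1}(col_mx_parts (u - v)) -scalemxAl mul_block_col mul1mx.
rewrite !mulmxBl -!scalemxAl mul1mx -mulmxA.
rewrite snd_partD snd_partN eE !mul_mx_scalar -raddfD /=.
rewrite !spec_val2E.
apply: parts_inj; rewrite !(fst_spec_vec, snd_spec_vec, partE).
  by field.
rewrite /zbar (negbTE u0) (negbTE v0) /normalize sqrrN expr1n.
apply/colP => i; rewrite !mxE.
move: (enorm _) (enorm _) r0 s0 => r s r0 s0.
by field; rewrite !gt_eqF.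
Qed.

Lemma mid_slope_cvg z : snd_part z != 0 ->
  mid_slope uv @[uv --> (z, z)] --> mid_jacobian z.
Proof.
move=> z0; have r0 : enorm (snd_part z) != 0 by rewrite enorm_eq0.
(* The Jacobian is the slope on the diagonal, where [e] becomes the normalized [z_2]; continuity of
   each block then suffices. *)
have -> : mid_jacobian z = mid_slope (z, z).
  rewrite /mid_jacobian /mid_slope /=.
  have -> : (enorm (snd_part z) + enorm (snd_part z))^-1 *:
      (snd_part z + snd_part z) = normalize (snd_part z).
    by apply/colP => i; rewrite !mxE; field; rewrite -?mulr2n ?mulrn_eq0 r0.
  rewrite scalar_mx_block !scale_block_mx add_block_mx; congr block_mx.
  - by apply/matrixP => i j; rewrite !mxE; case: (_ == _); field.
  - by rewrite scaler0 add0r.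
  - by rewrite scaler0 add0r.
  - rewrite -scalemxAl; apply/matrixP => i j; rewrite !mxE.
    by case: (_ == _); field; rewrite r0.
have u1 : uv.1 @[uv --> (z, z)] --> z by exact: cvg_fst.
have u2 : uv.2 @[uv --> (z, z)] --> z by exact: cvg_snd.
have [f1 f2] := (cvg_fst_part u1, cvg_fst_part u2).
have [s1 s2] := (cvg_snd_part u1, cvg_snd_part u2).
have [n1 n2] := (cvg_enorm s1, cvg_enorm s2).
have [i1 i2] := (cvgV r0 n1, cvgV r0 n2).
have e1 : (enorm (snd_part uv.1) + enorm (snd_part uv.2))^-1 *:
    (snd_part uv.1 + snd_part uv.2) @[uv --> (z, z)] -->
    (enorm (snd_part z) + enorm (snd_part z))^-1 *: (snd_part z + snd_part z).
  apply: cvgZ; last exact: cvgD.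
  apply: cvgV; last exact: cvgD.
  by rewrite -mulr2n mulrn_eq0.
apply: cvgZ; first exact: cvg_cst.
apply: cvg_block_mx; first exact: cvg_cst.
- exact: cvg_trmx.
- exact: cvgZ.
- apply: cvgB; apply: cvgZ.
  + by apply: cvgD; [exact: cvg_cst|exact: cvgM].
  + exact: cvg_cst.
  + by apply: cvgM => //; exact: cvgM.
  + by apply: cvg_mulmx => //; exact: cvg_trmx.
Qed.

(** Away from [z_2 = 0] the gradient of [spec_val i] is [2 c_i]. *)
Lemma spec_val_quot_cvg i z h w : snd_part z != 0 ->
  t^-1 * (spec_val i (z + t *: h) - spec_val i z) @[t --> (0 : R)^'+] -->
  2 * dot (spec_vec w i z) h.
Proof.
move=> z0; have r0 : 0 < enorm (snd_part z) by rewrite enorm_gt0.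
(* The difference quotient with its norm increment rationalized: equal to it for [t > 0], and
   continuous at [t = 0]. *)
pose g (t : R) := fst_part h + (-1) ^+ i *
  ((enorm (snd_part z + t *: snd_part h) + enorm (snd_part z))^-1 *
   dot (snd_part z + t *: snd_part h + snd_part z) (snd_part h)).
have -> : 2 * dot (spec_vec w i z) h = g 0.
  rewrite /g !scale0r !addr0 dot_parts fst_spec_vec snd_spec_vec /zbar.
  rewrite (negbTE z0) /normalize !dot_bilinear; field.
  by rewrite !gt_eqF ?addr_gt0.
have gc : g t @[t --> (0 : R)^'+] --> g 0.
  apply: cvg_at_right_filter.
  have c : snd_part z + t *: snd_part h @[t --> (0 : R)] -->
      snd_part z + 0 *: snd_part h.
    apply: cvgD; first exact: cvg_cst.
    by apply: cvgZ; [exact: cvg_id|exact: cvg_cst].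
  apply: cvgD; first exact: cvg_cst.
  apply: cvgM; first exact: cvg_cst.
  apply: cvgM.
    apply: cvgV; first by rewrite scale0r addr0 gt_eqF ?addr_gt0.
    by apply: cvgD; [exact: cvg_enorm|exact: cvg_cst].
  apply: cvg_dot; last exact: cvg_cst.
  by apply: cvgD => //; exact: cvg_cst.
apply: cvg_trans gc; apply: near_eq_cvg; near=> t.
have t0 : 0 < t by near: t; exact: nbhs_right_gt.
rewrite /g /spec_val !partE.
set y := snd_part z + t *: snd_part h.
have s0 : 0 < enorm y + enorm (snd_part z) by rewrite ltr_wpDl ?enorm_ge0.
have : (enorm y - enorm (snd_part z)) * (enorm y + enorm (snd_part z)) =
    t * dot (y + snd_part z) (snd_part h).
  rewrite enormB_mul -dotZr; congr dot; by rewrite /y addrC addKr.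
move: (dot _ _) (enorm y) (enorm (snd_part z)) s0 => d a b s0 E.
have -> : d = t^-1 * ((a - b) * (a + b)) by rewrite E mulKf // gt_eqF.
by field; rewrite !gt_eqF.
Unshelve. all: by end_near. Qed.

Lemma bd_snd_part_neq0 z : soc_bd z -> z != 0 -> snd_part z != 0.
Proof.
move=> zbd; apply: contraNneq => z20; apply/eqP/parts_inj.
  by rewrite zbd z20 enorm0 /fst_part !mxE.
by rewrite z20 -(scale0r z) snd_partZ scale0r.
Qed.

Lemma cvg_nbhs z : u @[u --> z] --> z.
Proof. exact: cvg_id. Qed.

Lemma cvg_line z h : z + t *: h @[t --> (0 : R)^'+] --> z.
Proof.
rewrite -[X in _ --> X]addr0 -(scale0r h); apply: cvg_at_right_filter.
apply: cvgD; first exact: cvg_cst.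
by apply: cvgZ; [exact: cvg_id|exact: cvg_cst].
Qed.

Lemma spec_valZ i (t : R) z : 0 <= t -> spec_val i (t *: z) = t * spec_val i z.
Proof. by move=> t0; rewrite /spec_val !partE enormZ ger0_norm //; ring. Qed.

Lemma spec_vecZ w i (t : R) z : 0 < t -> spec_vec w i (t *: z) = spec_vec w i z.
Proof.
move=> t0; rewrite /spec_vec /zbar snd_partZ scaler_eq0 (gt_eqF t0) /=.
case: ifP => // _; congr (_ *: col_mx _ (_ *: _)).
by rewrite /normalize enormZ gtr0_norm // scalerA invfM mulrAC mulVf ?mul1r ?gt_eqF.
Qed.

Lemma soc_projZ w (t : R) z : 0 < t -> soc_proj w (t *: z) = t *: soc_proj w z.
Proof.
move=> t0; have t0' := ltW t0.
by rewrite /soc_proj !spec_vecZ // !spec_valZ // !pos_partZ // scalerDr !scalerA.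
Qed.

(** * The projection on each region: interiors, complement of both cones, boundaries, origin *)

Section UnitVector.
Context (w : 'cV[R]_n) (w1 : enorm w = 1).
Let P : V -> V := metric_proj soc.

(** [spec_val 1 > 0] is an open condition under which the projection is the identity, so the slope
    is the constant identity matrix. *)
Lemma proj_strict_int z : soc_int z ->
  strictly_frechet_differentiable P z /\ forall h, nabla P z h = h.
Proof.
move=> zK; have l1 : 0 < spec_val 1 z by rewrite spec_val1E subr_gt0.
have [|sd nE] := @strict_slope _ _ P z (cst 1%:M) 1%:M _ (cvg_cst _).
  have /near_diag : \forall u \near z, 0 < spec_val 1 u.
    exact: (cvgr_gt _ (cvg_spec_val (@cvg_nbhs z)) _ l1).
  apply: filterS => -[u v] /= [lu lv].
  by rewrite mul1mx /P !(metric_proj_soc _ w1) !soc_proj_id // ltW.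
by split=> // h; rewrite nE mul1mx.
Qed.

Lemma proj_strict_opp_int z : opp_set soc_int z ->
  strictly_frechet_differentiable P z /\ forall h, nabla P z h = 0.
Proof.
move=> /opp_setP; rewrite /soc_int /= !partE enormN => zK.
have l2 : spec_val 2 z < 0 by rewrite spec_val2E; move: zK; lra.
have [|sd nE] := @strict_slope _ _ P z (cst 0) 0 _ (cvg_cst _).
  have /near_diag : \forall u \near z, spec_val 2 u < 0.
    exact: (cvgr_lt _ (cvg_spec_val (@cvg_nbhs z)) _ l2).
  apply: filterS => -[u v] /= [lu lv].
  by rewrite mul0mx /P !(metric_proj_soc _ w1) !soc_proj_eq0 ?subrr // ltW.
by split=> // h; rewrite nE mul0mx.
Qed.

(** Here [spec_val 1 < 0 < spec_val 2], which forces [z_2] to be nonzero. These conditions are open,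
    and under them the projection is [spec_val 2] times [c_2]. *)
Lemma proj_strict_mid z : (~` (opp_set soc `|` soc)) z ->
  strictly_frechet_differentiable P z /\
  forall h, nabla P z h = mid_jacobian z *m h.
Proof.
move=> zK.
have l1 : spec_val 1 z < 0.
  rewrite spec_val1E subr_lt0 ltNge; apply/negP => H; apply: zK; by right.
have l2 : 0 < spec_val 2 z.
  rewrite spec_val2E ltNge; apply/negP => H; apply: zK; left; apply/opp_setP.
  by rewrite /soc /= !partE enormN; move: H; lra.
have z0 : snd_part z != 0.
  by rewrite -enorm_gt0; move: l1 l2; rewrite spec_val1E spec_val2E; lra.
apply: strict_slope (mid_slope_cvg z0).
have /near_diag : \forall u \near z,
    [/\ spec_val 1 u < 0, 0 < spec_val 2 u & snd_part u != 0].
  near=> u; split; near: u.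
  - exact: (cvgr_lt _ (cvg_spec_val (@cvg_nbhs z)) _ l1).
  - exact: (cvgr_gt _ (cvg_spec_val (@cvg_nbhs z)) _ l2).
  - exact: (cvgr_neq0 _ (cvg_snd_part (@cvg_nbhs z)) z0).
apply: filterS => -[u v] /= [[lu1 lu2 u0] [lv1 lv2 v0]].
rewrite -(mid_slopeP w) // /P !(metric_proj_soc _ w1).
by rewrite !soc_projE_pos ?(ltW lu1) ?(ltW lv1) // /pos_part !max_r // ltW.
Unshelve. all: by end_near. Qed.

(** At such [z], [spec_val 1] vanishes and [z] is its own projection. The quotient is [h] minus
    [t^-1] times the negative part of [spec_val 1 (z + t *: h)], times [c_1]; positive homogeneity
    moves [t^-1] inside the negative part. *)
Lemma proj_dir_cvg_bd z h w' : enorm w' = 1 -> soc_bd z -> z != 0 ->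
  dir_quot P z h t @[t --> (0 : R)^'+] -->
  h - (2 * neg_part (dot (spec_vec w' 1 z) h)) *: spec_vec w' 1 z.
Proof.
move=> w'1 zbd zn0; have z0 := bd_snd_part_neq0 zbd zn0.
have l1 : spec_val 1 z = 0 by rewrite spec_val1E zbd subrr.
have l2 : 0 < spec_val 2 z by rewrite spec_val2E zbd addr_gt0 ?enorm_gt0.
have lin := @cvg_line z h.
rewrite -neg_partZ //.
have q : h - neg_part (t^-1 * (spec_val 1 (z + t *: h) - spec_val 1 z)) *:
    spec_vec w' 1 (z + t *: h) @[t --> (0 : R)^'+] -->
    h - neg_part (2 * dot (spec_vec w' 1 z) h) *: spec_vec w' 1 z.
  apply: cvgB; first exact: cvg_cst.
  apply: cvgZ; last exact: cvg_spec_vec.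
  exact/cvg_neg_part/spec_val_quot_cvg.
apply: cvg_trans q; apply: near_eq_cvg; near=> t.
have t0 : 0 < t by near: t; exact: nbhs_right_gt.
have lt : 0 < spec_val 2 (z + t *: h).
  by near: t; exact: (cvgr_gt _ (cvg_spec_val lin) _ l2).
rewrite /dir_quot /P !(metric_proj_soc _ w'1) (soc_proj_id _ (z := z)) ?l1 //.
rewrite soc_projE_sub ?ltW // subr0 neg_partZ ?invr_ge0 ?(ltW t0) //.
by rewrite addrAC (addrC z) addrK scalerBr !scalerA mulVf ?gt_eqF // scale1r.
Unshelve. all: by end_near. Qed.

(** The mirror case: [spec_val 2] vanishes, [spec_val 1 < 0], and [z] projects to 0. *)
Lemma proj_dir_cvg_opp_bd z h w' : enorm w' = 1 -> opp_set soc_bd z -> z != 0 ->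
  dir_quot P z h t @[t --> (0 : R)^'+] -->
  (2 * pos_part (dot (spec_vec w' 2 z) h)) *: spec_vec w' 2 z.
Proof.
move=> w'1 /opp_setP zbd zn0.
have z0 : snd_part z != 0.
  by rewrite -oppr_eq0 -snd_partN bd_snd_part_neq0 ?oppr_eq0.
move: zbd; rewrite /soc_bd /= !partE enormN => zbd.
have r0 : 0 < enorm (snd_part z) by rewrite enorm_gt0.
have l1 : spec_val 1 z < 0 by rewrite spec_val1E; move: r0 zbd; lra.
have l2 : spec_val 2 z = 0 by rewrite spec_val2E; move: r0 zbd; lra.
have lin := @cvg_line z h.
rewrite -pos_partZ //.
have q : pos_part (t^-1 * (spec_val 2 (z + t *: h) - spec_val 2 z)) *:
    spec_vec w' 2 (z + t *: h) @[t --> (0 : R)^'+] -->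
    pos_part (2 * dot (spec_vec w' 2 z) h) *: spec_vec w' 2 z.
  apply: cvgZ; last exact: cvg_spec_vec.
  exact/cvg_pos_part/spec_val_quot_cvg.
apply: cvg_trans q; apply: near_eq_cvg; near=> t.
have t0 : 0 < t by near: t; exact: nbhs_right_gt.
have lt : spec_val 1 (z + t *: h) < 0.
  by near: t; exact: (cvgr_lt _ (cvg_spec_val lin) _ l1).
rewrite /dir_quot /P !(metric_proj_soc _ w'1) (soc_proj_eq0 _ (z := z)) ?l2 //.
by rewrite soc_projE_pos ?ltW // !subr0 pos_partZ ?invr_ge0 ?(ltW t0) // -scalerA.
Unshelve. all: by end_near. Qed.

(** The projection is positively homogeneous and fixes 0, so the quotient is constant in [t > 0]. *)
Lemma proj_dir_cvg0 h w' : enorm w' = 1 ->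
  dir_quot P 0 h t @[t --> (0 : R)^'+] --> soc_proj w' h.
Proof.
move=> w'1; apply: cvg_trans (cvg_cst (F := (0 : R)^'+) (soc_proj w' h)).
apply: near_eq_cvg; near=> t.
have t0 : 0 < t by near: t; exact: nbhs_right_gt.
rewrite /dir_quot /P !(metric_proj_soc _ w'1) add0r soc_projZ //.
rewrite (soc_proj_eq0 _ (z := 0)); last by rewrite -(scale0r 0) spec_valZ ?mul0r.
by rewrite subr0 scalerA mulVf ?gt_eqF // scale1r.
Unshelve. all: by end_near. Qed.

Lemma spec_vec_neq0 i z : spec_vec w i z != 0.
Proof.
apply/eqP => /(congr1 fst_part) /eqP.
by rewrite fst_spec_vec /fst_part !mxE invr_eq0 pnatr_eq0.
Qed.

Lemma proj_not_frechet z : (opp_set soc_bd `|` soc_bd) z ->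
  ~ frechet_differentiable P z.
Proof.
have half i z' : i \in [:: 1; 2]%N ->
    dot (spec_vec w i z') (spec_vec w i z') = 2^-1.
  by rewrite !inE dot_spec_vec // => /orP[] /eqP ->; rewrite /= ?exprD; field.
move=> zbd; have [->|zn0] := eqVneq z 0.
  (* On the axis [h = (1, 0)] projects to itself and [- h] to 0, so the two limits add up to [h]. *)
  pose h : V := col_mx 1%:M 0.
  apply: (not_frechet_differentiable (proj_dir_cvg0 (h := h) w1)
    (proj_dir_cvg0 (h := - h) w1)).
  rewrite soc_proj_id ?soc_proj_eq0 ?spec_val1E ?spec_val2E ?partE ?oppr0 ?enorm0.
  - rewrite addr0; apply/eqP => /(congr1 fst_part) /eqP.
    by rewrite partE /fst_part !mxE oner_eq0.
  - by rewrite addr0 oppr_le0.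
  - by rewrite subr0.
case: zbd => zbd.
  (* Along [c_2] the limit is [c_2], along [- c_2] it is 0. *)
  apply: (not_frechet_differentiable (proj_dir_cvg_opp_bd (h := spec_vec w 2 z) w1 zbd zn0)
    (proj_dir_cvg_opp_bd (h := - spec_vec w 2 z) w1 zbd zn0)).
  rewrite dotNr half // /pos_part [Num.max 0 2^-1]max_r ?invr_ge0 //.
  rewrite max_l ?oppr_le0 ?invr_ge0 // mulr0 scale0r addr0 mulfV // scale1r.
  exact: spec_vec_neq0.
(* Along [c_1] the limit is [c_1]; along [- c_1] the correction term cancels the direction and
   leaves 0. *)
apply: (not_frechet_differentiable (proj_dir_cvg_bd (h := spec_vec w 1 z) w1 zbd zn0)
  (proj_dir_cvg_bd (h := - spec_vec w 1 z) w1 zbd zn0)).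
rewrite dotNr half // /neg_part [Num.min 0 2^-1]min_l ?invr_ge0 //.
rewrite min_r ?oppr_le0 ?invr_ge0 // mulr0 scale0r subr0 mulrN mulfV //.
by rewrite scaleN1r opprK addNr addr0 spec_vec_neq0.
Qed.

Lemma proj_gateaux z : (opp_set soc_bd `|` soc_bd) z ->
  gateaux_dir_differentiable P z.
Proof.
move=> zbd h; apply/cvg_ex; have [->|zn0] := eqVneq z 0.
  by eexists; apply: proj_dir_cvg0 w1.
case: zbd => zbd; eexists.
  exact: (proj_dir_cvg_opp_bd (h := h) w1 zbd zn0).
exact: (proj_dir_cvg_bd (h := h) w1 zbd zn0).
Qed.

End UnitVector.
End ConeProjection.

Theorem theorem4p2 (R : realType) (m : nat) (hm : (2 <= m)%N) :
  let K : set 'cV[R]_(1 + m.-1) := soc in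
  let Ko : set 'cV[R]_(1 + m.-1) := soc_int in
  let bdK : set 'cV[R]_(1 + m.-1) := soc_bd in
  let P := metric_proj K in
  (* (i) *)
  (forall z, Ko z ->
    strictly_frechet_differentiable P z /\ forall h, nabla P z h = h) /\
  (* (ii) *)
  (forall z, opp_set Ko z ->
    strictly_frechet_differentiable P z /\ forall h, nabla P z h = 0) /\
  (* (iii) *)
  (forall z, (~` (opp_set K `|` K)) z ->
    strictly_frechet_differentiable P z /\
    forall h, nabla P z h = mid_jacobian z *m h) /\
  (* (iv)(a) *)
  (forall z, (opp_set bdK `|` bdK) z ->
    gateaux_dir_differentiable P z /\
    forall (h : 'cV[R]_(1 + m.-1)) (w : 'cV[R]_m.-1), enorm w = 1 ->
      let c := spec_vec w in
      ((bdK `\ 0) z ->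
        dir_deriv P z h =
          h - (2 * neg_part (dot (c 1%N z) h)) *: c 1%N z) /\
      ((opp_set bdK `\ 0) z ->
        dir_deriv P z h = (2 * pos_part (dot (c 2%N z) h)) *: c 2%N z) /\
      (z = 0 ->
        dir_deriv P z h =
          pos_part (spec_val 1 h) *: c 1%N h
          + pos_part (spec_val 2 h) *: c 2%N h)) /\
  (* (iv)(b) *)
  (forall z, (opp_set bdK `|` bdK) z -> ~ frechet_differentiable P z).
Proof.
have n0 : (0 < m.-1)%N by case: m hm => [|[]].
move=> K Ko bdK P.
(* As [m >= 2], the second factor has a first basis vector, which supplies the unit vector for the
   spectral formula. *)
pose w : 'cV[R]_m.-1 := delta_mx (Ordinal n0) ord0.
have w1 : enorm w = 1.
  rewrite /enorm dotE (bigD1 (Ordinal n0)) //= big1 => [|i iN0].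
    by rewrite !mxE !eqxx mulr1 addr0 sqrtr1.
  by rewrite !mxE (negbTE iN0) mulr0.
split; first by move=> z; exact: (proj_strict_int w1).
split; first by move=> z; exact: (proj_strict_opp_int w1).
split; first by move=> z; exact: (proj_strict_mid w1).
split; last by move=> z; exact: (proj_not_frechet w1).
move=> z zbd; split=> [|h w' w'1 c]; first exact: (proj_gateaux w1 zbd).
split=> [[zK /eqP z0]|]; first exact/dir_deriv_eq/proj_dir_cvg_bd.
split=> [[zK /eqP z0]|->]; first exact/dir_deriv_eq/proj_dir_cvg_opp_bd.
exact/dir_deriv_eq/proj_dir_cvg0.
Qed.
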